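(* (1) Let $\mathsf{L}$ and $\mathsf{L}'$ be simplicial complexes. (i) If $\mathrm{C}(\mathsf{L}';\mathsf{H})>\mathrm{C}(\mathsf{L};\mathsf{H})$ for some simplicial complex $\mathsf{H}$, then there is no facet simplicial map from $\mathsf{L}'$ to $\mathsf{L}$. (ii) If $\mathrm{IC}(\mathsf{L}';\mathsf{H})>\mathrm{IC}(\mathsf{L};\mathsf{H})$ for some simplicial complex $\mathsf{H}$, then there is no injective facet simplicial map from $\mathsf{L}'$ to $\mathsf{L}$. (2) Let $\mathsf{H}$ and $\mathsf{H}'$ be simplicial complexes. (i) If $\mathrm{C}(\mathsf{L};\mathsf{H})>\mathrm{C}(\mathsf{L};\mathsf{H}')$ for some simplicial complex $\mathsf{L}$, then there is no facet simplicial map from $\mathsf{H}'$ to $\mathsf{H}$. (ii) If $\mathrm{IC}(\mathsf{L};\mathsf{H})>\mathrm{IC}(\mathsf{L};\mathsf{H}')$ for some simplicial complex $\mathsf{L}$, then there is no injective facet simplicial map from $\mathsf{H}'$ to $\mathsf{H}$.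
   Context: A simplicial complex is an abstract simplicial complex: a set $\mathsf{K}$ of subsets (simplices) of a vertex set $V(\mathsf{K})=\bigcup\mathsf{K}$ such that $F\in\mathsf{K}$ and $G\subseteq F$ imply $G\in\mathsf{K}$. A facet is a simplex that is maximal with respect to inclusion; a facet is non-unitary if it has at least two vertices. A subcomplex of $\mathsf{K}$ is a simplicial complex contained in $\mathsf{K}$. The union of simplicial complexes is the union of their vertex sets and of their sets of simplices. A simplicial map $f:\mathsf{L}\to\mathsf{K}$ is a map $f:V(\mathsf{L})\to V(\mathsf{K})$ such that $f(F)\in\mathsf{K}$ whenever $F\in\mathsf{L}$; it is injective if it is injective on vertices. A facet simplicial map is a simplicial map $f:\mathsf{L}\to\mathsf{K}$ such that $f(F)$ is a non-unitary facet of $\mathsf{K}$ whenever $F$ is a non-unitary facet of $\mathsf{L}$. The facet-complexity $\mathrm{C}(\mathsf{L};\mathsf{K})$ is the least positive integer $k$ such that there exist subcomplexes $\mathsf{L}_1,\ldots,\mathsf{L}_k$ of $\mathsf{L}$ with $\mathsf{L}=\mathsf{L}_1\cup\cdots\cup\mathsf{L}_k$ and, for each $i$, a facet simplicial map $f_i:\mathsf{L}_i\to\mathsf{K}$; it is $\infty$ if no such $k$ exists. The injective facet-complexity $\mathrm{IC}(\mathsf{L};\mathsf{K})$ is defined in the same way, requiring each $f_i$ to be an injective facet simplicial map. *)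

(* Defs.v *)
From HB Require Import structures.
From mathcomp Require Import all_boot all_order all_algebra.
From mathcomp Require Import mathcomp_extra boolp classical_sets.
From mathcomp Require Import constructive_ereal.

Set Implicit Arguments.
Unset Strict Implicit.
Unset Printing Implicit Defensive.

Local Open Scope classical_set_scope.

(* Neither the complex nor its simplices are assumed finite or nonempty. *)
Record scomplex (T : Type) := SComplex {
  simplices : set (set T);
  simplicesS : forall F G : set T, simplices F -> G `<=` F -> simplices G
}.

Definition vertices (T : Type) (K : scomplex T) : set T :=
  \bigcup_(F in simplices K) F.

Definition facet (T : Type) (K : scomplex T) (F : set T) : Prop :=
  simplices K F /\ forall G : set T, simplices K G -> F `<=` G -> G = F.

Definition nonunitary_facet (T : Type) (K : scomplex T) (F : set T) : Prop :=
  facet K F /\ exists x y : T, [/\ F x, F y & x <> y].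

(* A vertex map goes between the subtypes of vertices, not between the ambient
   types: a complex without vertices then maps to every complex, even when the
   ambient type of the target is empty. *)
Definition vimage (T U : Type) (L : scomplex T) (K : scomplex U)
    (f : vertices L -> vertices K) (F : set T) : set U :=
  [set val (f v) | v in [set v : vertices L | F (val v)]].

Definition simplicial_map (T U : Type) (L : scomplex T) (K : scomplex U)
    (f : vertices L -> vertices K) : Prop :=
  forall F : set T, simplices L F -> simplices K (vimage f F).

Definition facet_simplicial_map (T U : Type) (L : scomplex T) (K : scomplex U)
    (f : vertices L -> vertices K) : Prop :=
  simplicial_map f /\
  forall F : set T, nonunitary_facet L F -> nonunitary_facet K (vimage f F).

Definition injective_facet_simplicial_map (T U : Type)
    (L : scomplex T) (K : scomplex U) (f : vertices L -> vertices K) : Prop :=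
  facet_simplicial_map f /\ injective f.

(* Equality of the sets of simplices makes each [Ls i] a subcomplex of [L], and
   the vertex set of [L] the union of the vertex sets of the [Ls i]. *)
Definition coverable (T : Type) (L : scomplex T) (P : scomplex T -> Prop)
    (k : nat) : Prop :=
  exists Ls : 'I_k -> scomplex T,
    simplices L = \bigcup_i simplices (Ls i) /\ forall i, P (Ls i).

(* The least positive integer satisfying [P], or +oo if there is none. *)
Definition least_pos (P : nat -> Prop) : \bar int :=
  if pselect (exists k, (0 < k)%N && `[< P k >]) is left exP
  then (Posz (ex_minn exP))%:E else +oo%E.

Definition facet_complexity (T U : Type) (L : scomplex T) (K : scomplex U) :
    \bar int :=
  least_pos (coverable L (fun Li =>
    exists f : vertices Li -> vertices K, facet_simplicial_map f)).

Definition injective_facet_complexity (T U : Type)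
    (L : scomplex T) (K : scomplex U) : \bar int :=
  least_pos (coverable L (fun Li =>
    exists f : vertices Li -> vertices K, injective_facet_simplicial_map f)).

(* Main.v *)
(* A facet simplicial map g : L' -> L pulls a cover (L_i) of L back to the cover
   of L' by the complexes generated by those simplices G of L' all of whose
   cofaces are sent by g into L_i. A facet of such a complex is a facet of L',
   so g restricts to facet simplicial maps into the L_i; the naive preimages of
   the L_i do not have this property. They cover L' even when simplices lie in
   no facet: above any F, choose G minimizing the finite number of indices i
   with g(G) in L_i; this set of indices is then constant above G. *)

Require Import Defs.
From mathcomp Require Import all_boot all_order all_algebra.
From mathcomp Require Import mathcomp_extra boolp classical_sets.
From mathcomp Require Import constructive_ereal.

Import Order.TTheory.

Set Implicit Arguments.
Unset Strict Implicit.
Unset Printing Implicit Defensive.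

Local Open Scope classical_set_scope.

(** This reduces each inequality of complexities, infinite values included, to carrying covers over
    with the same number of pieces. *)
Lemma least_pos_le (P Q : nat -> Prop) :
  (forall k, P k -> Q k) -> (least_pos Q <= least_pos P)%E.
Proof.
move=> PQ; rewrite /least_pos.
case: pselect => [exQ|nQ]; case: pselect => [exP|_] //=; rewrite ?leey //.
- rewrite lee_fin lez_nat.
  case: ex_minnP => m _ mmin; case: ex_minnP => n /andP[n0 /asboolP Pn] _.
  by apply: mmin; rewrite n0; apply/asboolP/PQ.
- by case: nQ; case: exP => k /andP[k0 /asboolP Pk];
    exists k; rewrite k0; apply/asboolP/PQ.
Qed.

Lemma coverableS (T : Type) (L : scomplex T) (P Q : scomplex T -> Prop) k :
  (forall K, P K -> Q K) -> coverable L P k -> coverable L Q k.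
Proof. by move=> PQ [Ls [LE PL]]; exists Ls; split=> // i; apply/PQ/PL. Qed.

Section Maps.
Context {T U : Type}.
Implicit Types (L : scomplex T) (K : scomplex U).

Lemma vimageS L K (f : vertices L -> vertices K) F G :
  F `<=` G -> vimage f F `<=` vimage f G.
Proof. by move=> FG _ [v Fv <-]; exists v => //; apply: FG. Qed.

Lemma vimage_comp V L K (M : scomplex V) (f : vertices L -> vertices K)
    (g : vertices K -> vertices M) F :
  vimage (g \o f) F = vimage g (vimage f F).
Proof.
apply/seteqP; split=> [_ [v Fv <-]|_ [w [v Fv vw] <-]].
  by exists (f v) => //; exists v.
by exists v => //=; rewrite (val_inj vw).
Qed.

Lemma facet_simplicial_map_comp V L K (M : scomplex V)
    (f : vertices L -> vertices K) (g : vertices K -> vertices M) :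
  facet_simplicial_map f -> facet_simplicial_map g ->
  facet_simplicial_map (g \o f).
Proof.
move=> [sf ff] [sg fg]; split=> F LF; rewrite vimage_comp.
  exact/sg/sf.
exact/fg/ff.
Qed.

Lemma injective_facet_simplicial_map_comp V L K (M : scomplex V)
    (f : vertices L -> vertices K) (g : vertices K -> vertices M) :
  injective_facet_simplicial_map f -> injective_facet_simplicial_map g ->
  injective_facet_simplicial_map (g \o f).
Proof.
move=> [ff injf] [fg injg]; split; last exact: inj_comp.
exact: facet_simplicial_map_comp.
Qed.

(** Vertex maps are typed by their complexes, so restricting both ends takes a new map. It is well
    defined because a vertex of [L1] lies in some simplex of [L1], whose image is a simplex of [K1].
    Images are compared only on simplices of [L1], since a general [F] may contain vertices of [L]
    outside [L1]. *)
Lemma vertices_restrict L L1 K K1 (f : vertices L -> vertices K) :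
  simplices L1 `<=` simplices L ->
  (forall F, simplices L1 F -> simplices K1 (vimage f F)) ->
  exists f1 : vertices L1 -> vertices K1,
    (forall F, simplices L1 F -> vimage f1 F = vimage f F) /\
    (injective f -> injective f1).
Proof.
move=> L1L fK1.
have vL (v : vertices L1) : val v \in vertices L.
  have /set_mem[F L1F Fv] := valP v.
  by apply/mem_set; exists F => //; apply: L1L.
pose i (v : vertices L1) : vertices L := Sub (val v) (vL v).
have vK (v : vertices L1) : val (f (i v)) \in vertices K1.
  have /set_mem[F L1F Fv] := valP v.
  by apply/mem_set; exists (vimage f F); [exact: fK1|exists (i v)].
exists (fun v => Sub (val (f (i v))) (vK v)); split=> [F L1F|injf v w].
  apply/seteqP; split=> [_ [v Fv <-]|_ [v Fv <-]].
    by exists (i v).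
  have vL1 : val v \in vertices L1 by apply/mem_set; exists F.
  exists (Sub (val v) vL1) => //.
  by rewrite SubK; congr (\val (f _)); apply: val_inj; rewrite !SubK.
move=> /(congr1 val) /= /val_inj /injf /(congr1 val) /=.
exact: val_inj.
Qed.

Definition pullback L K (f : vertices L -> vertices K) K1 : scomplex T.
Proof.
exists [set F | exists G, [/\ simplices L G, F `<=` G &
  forall G', simplices L G' -> G `<=` G' -> simplices K1 (vimage f G')]].
by move=> F F' [G [LG FG fG]] F'F; exists G; split=> //; apply: subset_trans FG.
Defined.

Section Pullback.
Context {L : scomplex T} {K : scomplex U} (f : vertices L -> vertices K).

Lemma pullback_sub K1 : simplices (pullback f K1) `<=` simplices L.
Proof. by move=> F [G [LG FG _]]; apply: simplicesS LG FG. Qed.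

Lemma pullback_vimage K1 F :
  simplices (pullback f K1) F -> simplices K1 (vimage f F).
Proof.
by move=> [G [LG FG fG]]; apply: (simplicesS (fG G LG _)) => //; apply: vimageS.
Qed.

Lemma facet_pullback K1 F : facet (pullback f K1) F -> facet L F.
Proof.
move=> [F1 Fmax]; split; first exact: pullback_sub F1.
have [G [LG FG fG]] := F1.
(* [G] is its own witness, so it belongs to the pullback and maximality collapses it to [F]. The
   condition on cofaces then holds for [F] itself and passes to every [F'] above it. *)
have GF : G = F by apply: Fmax => //; exists G; split.
rewrite {}GF in fG => F' LF' FF'; apply: Fmax => //.
exists F'; split=> // G' LG' F'G'; apply: fG => //; exact: subset_trans F'G'.
Qed.

Lemma pullback_facet_simplicial_map K1 :
  facet_simplicial_map f -> simplices K1 `<=` simplices K ->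
  exists f1 : vertices (pullback f K1) -> vertices K1,
    facet_simplicial_map f1 /\ (injective f -> injective f1).
Proof.
move=> [_ ff] K1K.
have [f1 [f1E injf1]] :=
  vertices_restrict (@pullback_sub K1) (@pullback_vimage K1).
exists f1; split=> //; split=> F F1.
  by rewrite f1E//; apply: pullback_vimage.
have [[sF Fmax] ntF] := F1; rewrite f1E//.
(* A facet of the pullback is a facet of [L], so its image is a facet of [K]; as this image lies in
   [K1], it is also maximal in that smaller complex. *)
have [[_ fFmax] ntfF] : nonunitary_facet K (vimage f F).
  by apply: ff; split=> //; apply: (@facet_pullback K1).
split=> //; split; first exact: pullback_vimage.
by move=> G K1G; apply: fFmax; apply: K1K.
Qed.

Lemma pullback_cover k (Ks : 'I_k -> scomplex U) :
  simplicial_map f -> simplices K = \bigcup_i simplices (Ks i) ->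
  simplices L = \bigcup_i simplices (pullback f (Ks i)).
Proof.
move=> sf KE; apply/seteqP; split=> [F LF|F [i _ /pullback_sub//]].
pose J G := [set i | `[< simplices (Ks i) (vimage f G) >]]%SET.
pose P n := `[< exists G, [/\ simplices L G, F `<=` G & #|J G| = n] >].
have exP : exists n, P n by exists #|J F|; apply/asboolP; exists F; split.
case: (ex_minnP exP) => n /asboolP[G [LG FG GE]] nmin.
have : simplices K (vimage f G) by exact: sf.
rewrite KE => -[i _ Gi]; exists i => //; exists G; split=> // G' LG' GG'.
(* Enlarging [G] enlarges its image, and each [Ks j] is closed under subsets, so the index set can
   only shrink. *)
have JG'G : J G' \subset J G.
  apply/fintype.subsetP => j; rewrite !inE => G'j.
  by apply: simplicesS G'j _; apply: vimageS.
(* [G'] also lies above [F], so minimality forbids a smaller index set; the index [i] found for [G]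
   thus serves all its cofaces. *)
have /eqP JE : J G' == J G.
  rewrite eqEcard JG'G GE; apply: nmin; apply/asboolP; exists G'; split=> //.
  exact: subset_trans GG'.
have : i \in J G' by rewrite JE !inE.
by rewrite !inE.
Qed.

(** Abstract [P] and [Q] let one transfer serve both complexities: the hypothesis linking them is
    later met by composing [f1] with the map carried by a piece of the cover. *)
Lemma coverable_pullback (P : scomplex U -> Prop) (Q : scomplex T -> Prop) k :
  facet_simplicial_map f ->
  (forall L1 K1 (f1 : vertices L1 -> vertices K1), facet_simplicial_map f1 ->
    (injective f -> injective f1) -> P K1 -> Q L1) ->
  coverable K P k -> coverable L Q k.
Proof.
move=> ff PQ [Ks [KE PK]]; exists (fun i => pullback f (Ks i)); split.
  by apply: pullback_cover => //; case: ff.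
move=> i; have KsK : simplices (Ks i) `<=` simplices K.
  by rewrite KE => F KiF; exists i.
have [f1 [ff1 injf1]] := pullback_facet_simplicial_map ff KsK.
exact: PQ ff1 injf1 (PK i).
Qed.

End Pullback.
End Maps.

Theorem proposition3p10 :
  (forall (T T' : Type) (L : scomplex T) (L' : scomplex T'),
    ((exists (U : Type) (H : scomplex U),
        (facet_complexity L' H > facet_complexity L H)%E) ->
      ~ exists f : vertices L' -> vertices L, facet_simplicial_map f) /\
    ((exists (U : Type) (H : scomplex U),
        (injective_facet_complexity L' H >
          injective_facet_complexity L H)%E) ->
      ~ exists f : vertices L' -> vertices L,
          injective_facet_simplicial_map f)) /\
  (forall (U U' : Type) (H : scomplex U) (H' : scomplex U'),
    ((exists (T : Type) (L : scomplex T),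
        (facet_complexity L H > facet_complexity L H')%E) ->
      ~ exists f : vertices H' -> vertices H, facet_simplicial_map f) /\
    ((exists (T : Type) (L : scomplex T),
        (injective_facet_complexity L H >
          injective_facet_complexity L H')%E) ->
      ~ exists f : vertices H' -> vertices H,
          injective_facet_simplicial_map f)).
Proof.
split=> [T T' L L'|U U' H H']; split.
- move=> [U [H]] + [f ff]; apply/negP; rewrite -leNgt.
  apply: least_pos_le => k; apply: (coverable_pullback ff).
  move=> L1 K1 f1 ff1 _ [g fg]; exists (g \o f1).
  exact: facet_simplicial_map_comp.
- move=> [U [H]] + [f [ff injf]]; apply/negP; rewrite -leNgt.
  apply: least_pos_le => k; apply: (coverable_pullback ff).
  move=> L1 K1 f1 ff1 injf1 [g fg]; exists (g \o f1).
  by apply: injective_facet_simplicial_map_comp => //; split=> //; apply: injf1.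
(* When the target varies, the cover of [L] is kept and each map into [H'] is followed by [f]. *)
- move=> [T [L]] + [f ff]; apply/negP; rewrite -leNgt.
  apply: least_pos_le => k; apply: coverableS => K [g fg]; exists (f \o g).
  exact: facet_simplicial_map_comp.
- move=> [T [L]] + [f ff]; apply/negP; rewrite -leNgt.
  apply: least_pos_le => k; apply: coverableS => K [g fg]; exists (f \o g).
  exact: injective_facet_simplicial_map_comp.
Qed.
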